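(* Let $f:\mathbb{R}^n\to\mathbb{R}$ be a Lipschitz function which is directionally differentiable. Then the set of points of $\mathbb{R}^n$ at which $f$ is not differentiable is contained in a countable union of tangential sets.
   Context: $f:\mathbb{R}^n\to\mathbb{R}$ is called directionally differentiable if for every $x\in\mathbb{R}^n$ and every unit vector $\theta\in\mathbb{R}^n$ the one-sided limit $D_\theta f(x):=\lim_{\lambda\to0^+}\frac{f(x+\lambda\theta)-f(x)}{\lambda}$ exists (as a real number). For a linear subspace $V\subset\mathbb{R}^n$ write each $h\in\mathbb{R}^n$ as $h=h^V+h^{V^\perp}$ with $h^V\in V$, $h^{V^\perp}\in V^\perp$. For $0\le k\le n-1$, a set $E\subset\mathbb{R}^n$ is $k$-tangential if for every $x\in E$ there is a $k$-dimensional linear subspace $V_x$ such that whenever $h_i\ne0$, $x+h_i\in E$ and $h_i\to0$ as $i\to\infty$, one has $|h_i^{V_x^\perp}|/|h_i^{V_x}|\to0$ as $i\to\infty$ (the quotient being understood as $+\infty$ if $h_i^{V_x}=0$). A tangential set is an $(n-1)$-tangential set. *)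

(* Defs.v *)
From HB Require Import structures.
From mathcomp Require Import all_boot all_order all_algebra.
From mathcomp Require Import all_classical all_reals all_analysis.

Set Implicit Arguments.
Unset Strict Implicit.
Unset Printing Implicit Defensive.

Import Order.TTheory GRing.Theory Num.Theory.
Import numFieldNormedType.Exports.

Local Open Scope classical_set_scope.
Local Open Scope ring_scope.

(* The library norm `|x| on 'rV[R]_n is the sup norm, hence a separate
   Euclidean norm. *)
Definition enorm (R : realType) (n : nat) (x : 'rV[R]_n) : R :=
  Num.sqrt (\sum_(i < n) x 0 i ^+ 2).

Definition lipschitz_fun (R : realType) (n : nat) (f : 'rV[R]_n -> R) : Prop :=
  exists L : R, forall x y : 'rV[R]_n, `|f x - f y| <= L * enorm (x - y).

Definition directionally_differentiable (R : realType) (n : nat)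
    (f : 'rV[R]_n -> R) : Prop :=
  forall x theta : 'rV[R]_n, enorm theta = 1 ->
    cvg ((f (x + l *: theta) - f x) / l @[l --> (0 : R)^'+]).

(* As in mxalgebra, a matrix V : 'M_n stands for its row space. The rows u of
   the kernel of V^T are those with <u, v> = 0 for every v in V. *)
Definition orthocomp (R : realType) (n : nat) (V : 'M[R]_n) : 'M[R]_n :=
  kermx V^T.

Definition oproj (R : realType) (n : nat) (V : 'M[R]_n) (h : 'rV[R]_n) :
    'rV[R]_n :=
  h *m proj_mx V (orthocomp V).

Definition oproj_perp (R : realType) (n : nat) (V : 'M[R]_n) (h : 'rV[R]_n) :
    'rV[R]_n :=
  h *m proj_mx (orthocomp V) V.

Lemma orthocompP (R : realType) (n : nat) (V : 'M[R]_n) (u : 'rV[R]_n) :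
  (u <= orthocomp V)%MS <->
  (forall v : 'rV[R]_n, (v <= V)%MS -> \sum_(i < n) u 0 i * v 0 i = 0).
Proof.
have dotE (a b : 'rV[R]_n) : \sum_(i < n) a 0 i * b 0 i = (a *m b^T) 0 0.
  by rewrite mxE; apply: eq_bigr => i _; rewrite mxE.
split=> [/sub_kermxP uV v /submxP[w ->]|uV].
  by rewrite dotE trmx_mul mulmxA uV mul0mx mxE.
apply/sub_kermxP/rowP => j; rewrite mxE [RHS]mxE -[RHS](uV (row j V)) ?row_sub//.
by apply: eq_bigr => i _; rewrite !mxE.
Qed.

Lemma cap_orthocomp (R : realType) (n : nat) (V : 'M[R]_n) :
  (V :&: orthocomp V)%MS = 0.
Proof.
apply/eqP/rowV0P => u; rewrite sub_capmx => /andP[uV /orthocompP/(_ u uV)].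
move=> /eqP; rewrite psumr_eq0 => [/allP u0|i _]; last by rewrite -expr2 sqr_ge0.
apply/rowP => i; rewrite mxE; apply/eqP.
by have := u0 i (mem_index_enum i); rewrite -expr2 sqrf_eq0.
Qed.

Lemma oproj_decomp (R : realType) (n : nat) (V : 'M[R]_n) (h : 'rV[R]_n) :
  [/\ h = oproj V h + oproj_perp V h, (oproj V h <= V)%MS
    & (oproj_perp V h <= orthocomp V)%MS].
Proof.
split; [|exact: proj_mx_sub|exact: proj_mx_sub].
rewrite /oproj /oproj_perp add_proj_mx ?cap_orthocomp//.
rewrite submx_full// /row_full eqn_leq rank_leq_col/=.
rewrite (mxrank_disjoint_sum (cap_orthocomp V)) mxrank_ker mxrank_tr.
by rewrite subnKC// rank_leq_col.
Qed.

Definition slope_ratio (R : realType) (n : nat) (V : 'M[R]_n) (h : 'rV[R]_n) :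
    \bar R :=
  if oproj V h == 0 then +oo%E
  else (enorm (oproj_perp V h) / enorm (oproj V h))%:E.

Definition k_tangential (R : realType) (n k : nat) (E : set 'rV[R]_n) : Prop :=
  forall x : 'rV[R]_n, E x ->
    exists V : 'M[R]_n, \rank V = k /\
      forall h : nat -> 'rV[R]_n,
        (forall i, h i != 0) -> (forall i, E (x + h i)) ->
        h i @[i --> \oo] --> (0 : 'rV[R]_n) ->
        slope_ratio V (h i) @[i --> \oo] --> 0%E.

Definition tangential (R : realType) (n : nat) (E : set 'rV[R]_n) : Prop :=
  k_tangential n.-1 E.

(* Main.v *)
Require Import Defs.
From HB Require Import structures.
From mathcomp Require Import all_boot all_order all_algebra.
From mathcomp Require Import all_classical all_reals all_analysis.
From mathcomp Require Import lra.
Import Order.TTheory GRing.Theory Num.Theory.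
Import numFieldNormedType.Exports.
Local Open Scope classical_set_scope.
Local Open Scope ring_scope.

Set Implicit Arguments.
Unset Strict Implicit.
Unset Printing Implicit Defensive.

(* Write g_x for the one-sided directional derivative of f at x: it is
   positively homogeneous and Lipschitz, and f is differentiable at x as soon
   as g_x is additive.  Put D_x(w, v) = g_x(w + v) - g_x(w) - g_x(v).  The
   directions w with D_x(w, .) = 0 form a linear subspace, which is proper when
   f is not differentiable at x, and by compactness there is eta > 0 such that
   every w with |D_x(w, v)| <= eta |v| for all v already lies in it.  Cut the
   set of non-differentiability points into countably many pieces on which eta
   is fixed, the first-order expansion of f holds with error eta |v| / 4 for
   |v| < d, and the g_x are within eta / 4 of each other (the last by recording
   integer parts of a multiple of g_x on a finite net of the sphere).  If a
   piece accumulates at its point x in the direction w, comparing the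
   expansions of f at x and at nearby points of the piece gives
   |D_x(w, v)| <= eta |v| for all v, so w lies in a hyperplane that depends on
   x only. *)

(** * Comparison of the norms and compactness of the sup-norm unit sphere *)

Lemma mx_norm_le (R : realType) (m n : nat) (A : 'M[R]_(m, n)) (e : R) :
  0 <= e -> (forall i j, `|A i j| <= e) -> `|A| <= e.
Proof.
move=> e0 Ae; rewrite [leLHS]/Num.norm/= mx_normrE.
by apply/bigmax_leP; split=> // -[i j] _; exact: Ae.
Qed.

Lemma entry_le_mx_norm (R : realType) (m n : nat) (A : 'M[R]_(m, n)) i j :
  `|A i j| <= `|A|.
Proof.
rewrite [leRHS]/Num.norm/= mx_normrE; apply/bigmax_geP; right => /=.
by exists (i, j).
Qed.

Lemma mx_norm_le_enorm (R : realType) (n : nat) (x : 'rV[R]_n) :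
  `|x| <= enorm x.
Proof.
apply: mx_norm_le => [|i j]; first exact: sqrtr_ge0.
rewrite ord1 -sqrtr_sqr ler_wsqrtr// (bigD1 j)//= lerDl.
by apply: sumr_ge0 => k _; exact: sqr_ge0.
Qed.

Lemma enorm_le (R : realType) (n : nat) (x : 'rV[R]_n) :
  enorm x <= n%:R * `|x|.
Proof.
have nx0 : 0 <= n%:R * `|x| by rewrite mulr_ge0.
rewrite -(ger0_norm nx0) -sqrtr_sqr ler_wsqrtr//.
apply: (@le_trans _ _ (\sum_(i < n) `|x| ^+ 2)).
  apply: ler_sum => i _; rewrite -real_normK ?num_real//.
  by rewrite lerXn2r ?nnegrE// entry_le_mx_norm.
rewrite sumr_const card_ord -[leLHS]mulr_natl exprMn ler_wpM2r ?sqr_ge0//.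
by rewrite -natrX ler_nat; case: n {x nx0} => // n; rewrite expnS leq_pmulr.
Qed.

Lemma mulmx_norm_le (R : realType) (n p : nat) (A : 'M[R]_(n, p))
    (h : 'rV[R]_n) :
  `|h *m A| <= n%:R * `|A| * `|h|.
Proof.
apply: mx_norm_le => [|i j]; first by rewrite !mulr_ge0.
rewrite mxE (le_trans (ler_norm_sum _ _ _))//.
apply: (@le_trans _ _ (\sum_(k < n) `|h| * `|A|)).
  by apply: ler_sum => k _; rewrite normrM ler_pM// entry_le_mx_norm.
by rewrite sumr_const card_ord -[leLHS]mulr_natl [ `|h| * _]mulrC mulrA.
Qed.

Lemma mulmxr_continuous (R : realType) (n p : nat) (A : 'M[R]_(n, p)) :
  continuous (fun h : 'rV[R]_n => h *m A).
Proof.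
apply: (@bounded_linear_continuous _ _ _ (mulmxr A)).
apply/bounded_funP => r; exists (n%:R * `|A| * r) => x xr.
by rewrite (le_trans (mulmx_norm_le _ _))// ler_wpM2l// mulr_ge0.
Qed.

Lemma mulmxr_norm_continuous (R : realType) (n p : nat) (A : 'M[R]_(n, p)) :
  continuous (fun h : 'rV[R]_n => `|h *m A|).
Proof.
move=> h; apply: (@continuous_comp _ _ _ (fun h : 'rV[R]_n => h *m A)).
  exact: mulmxr_continuous.
exact: norm_continuous.
Qed.

Lemma unit_sphere_compact (R : realType) (n : nat) :
  compact [set w : 'rV[R]_n | `|w| = 1].
Proof.
apply: bounded_closed_compact.
  by exists 1; split; [rewrite num_real|move=> M M1 w /= ->; exact: ltW].
rewrite (_ : [set w : 'rV[R]_n | `|w| = 1] = Num.norm @^-1` [set 1])//.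
by apply: closed_comp => [w _|]; [exact: norm_continuous|exact: closed_eq].
Qed.

(** * Subspaces and hyperplanes as row spaces *)

(** Take [U] of maximal rank among the matrices whose row space lies in [P]: a vector of [P] outside
    [U] could be added to it and would raise the rank. *)
Lemma subspace_mx (F : fieldType) (n : nat) (P : 'rV[F]_n -> Prop) :
  P 0 -> (forall u v, P u -> P v -> P (u + v)) ->
  (forall a u, P u -> P (a *: u)) ->
  exists U : 'M[F]_n, forall w, (w <= U)%MS <-> P w.
Proof.
move=> P0 PD PZ.
pose Q r := `[< exists U : 'M[F]_n,
  \rank U = r /\ forall w, (w <= U)%MS -> P w >].
have Q0 : exists r, Q r.
  exists 0%N; apply/asboolP; exists 0; split; first exact: mxrank0.
  by move=> w; rewrite submx0 => /eqP ->.
have Qn r : Q r -> (r <= n)%N by move=> /asboolP[U [<- _]]; exact: rank_leq_col.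
case: (ex_maxnP Q0 Qn) => r /asboolP[U [rU UP]] rmax.
exists U => w; split=> [|Pw]; first exact: UP.
apply/negPn/negP => nwU.
suff : Q (\rank (U + w)%MS).
  move=> /rmax; rewrite leqNgt -rU => /negP; apply.
  by apply: rank_ltmx; rewrite /ltmx addsmxSl/= addsmx_sub submx_refl/=.
apply/asboolP; exists (U + w)%MS; split=> // v /sub_addsmxP[[a b] ->]/=.
apply: PD; first by apply: UP; rewrite submxMl.
by rewrite [b]mx11_scalar mul_scalar_mx; apply: PZ.
Qed.

(** A nonzero column [c] of [cokermx U] is a linear form vanishing on [U], and its kernel is the
    hyperplane; [w] witnesses that such a column exists. *)
Lemma hyperplane_above (F : fieldType) (n : nat) (U : 'M[F]_n) (w : 'rV[F]_n) :
  ~~ (w <= U)%MS -> exists V : 'M[F]_n, \rank V = n.-1 /\ (U <= V)%MS.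
Proof.
rewrite submxE => wU.
have [j wUj] : exists j, (w *m cokermx U) 0 j != 0.
  apply/existsP; apply: contraR wU => /existsPn w0.
  apply/eqP/rowP => j; rewrite [RHS]mxE; apply/eqP.
  by have := w0 j; rewrite negbK.
pose c := col j (cokermx U).
have c0 : c != 0.
  apply: contraNneq wUj => c0.
  have /rowP/(_ 0) : (w *m cokermx U) *m delta_mx j 0 = 0 :> 'rV_1.
    by rewrite -mulmxA -colE -/c c0 mulmx0.
  by rewrite -colE !mxE => ->.
exists (kermx c); split; last first.
  by apply/sub_kermxP; rewrite /c colE mulmxA mulmx_coker mul0mx.
rewrite mxrank_ker -subn1; congr (_ - _)%N.
by apply/eqP; rewrite eqn_leq rank_leq_col lt0n mxrank_eq0.
Qed.

(** * Additivity defect of a positively homogeneous Lipschitz function *)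

Definition defect (R : realType) (n : nat) (phi : 'rV[R]_n -> R)
    (w v : 'rV[R]_n) : R :=
  phi (w + v) - phi w - phi v.

Section PositivelyHomogeneous.
Variables (R : realType) (n : nat) (L : R) (phi : 'rV[R]_n -> R).
Hypothesis phiZ : forall t v, 0 <= t -> phi (t *: v) = t * phi v.
Hypothesis phi_lip : forall v w, `|phi v - phi w| <= L * `|v - w|.

Lemma lip_cst_ge0 (v : 'rV[R]_n) : v != 0 -> 0 <= L.
Proof.
move=> v0; have := phi_lip v 0; rewrite subr0 => /(le_trans (normr_ge0 _)).
by rewrite pmulr_lge0// normr_gt0.
Qed.

Lemma defectZ t w v : 0 <= t ->
  defect phi (t *: w) (t *: v) = t * defect phi w v.
Proof. by move=> t0; rewrite /defect -scalerDr !phiZ// !mulrBr. Qed.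

Lemma defect_lip w w' v :
  `|defect phi w v - defect phi w' v| <= 2 * L * `|w - w'|.
Proof.
have h1 := phi_lip (w + v) (w' + v); have h2 := phi_lip w w'.
rewrite opprD addrACA subrr addr0 in h1.
rewrite /defect; move: h1 h2; rewrite !ler_norml => /andP[? ?] /andP[? ?].
by apply/andP; split; lra.
Qed.

(** Closure under sums is the cocycle identity D(u + w, v) = D(u, w + v) + D(w, v) - D(u, w), where
    D is the defect. *)
Lemma additive_directions_mx :
  exists U : 'M[R]_n, forall w, (w <= U)%MS <-> forall v, defect phi w v = 0.
Proof.
have phi0 : phi 0 = 0 by rewrite -[X in phi X](scale0r 0) phiZ// mul0r.
apply: (@subspace_mx _ _ (fun w => forall v, defect phi w v = 0)).
- by move=> v; rewrite /defect add0r phi0 subr0 subrr.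
- move=> u w hu hw v; move: (hu (w + v)) (hw v) (hu w); rewrite /defect addrA.
  by move=> ? ? ?; lra.
- have pos a w : 0 < a -> (forall v, defect phi w v = 0) ->
    forall v, defect phi (a *: w) v = 0.
    move=> a0 hw v; rewrite -[v](scalerKV (lt0r_neq0 a0)) defectZ ?ltW//.
    by rewrite hw mulr0.
  move=> a w hw; have [a0|a0|->] := ltgtP a 0; last first.
  + by move=> v; rewrite scale0r /defect add0r phi0 subr0 subrr.
  + exact: pos.
  (* Homogeneity covers positive scalars only; the sign is reversed by D(-w, v) = D(w, -w) - D(w, v
     - w). *)
  + rewrite -[a]opprK scaleNr -scalerN; apply: pos; first by rewrite oppr_gt0.
    move=> v; move: (hw (v - w)) (hw (- w)); rewrite /defect subrr phi0.
    by rewrite [w + (v - w)]addrC subrK [- w + v]addrC => ? ?; lra.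
Qed.

(* Modulo the subspace U of exactly additive directions, no direction of the
   unit sphere is additive, so by compactness the failure is uniform. *)
Lemma additivity_gap : (exists w v, defect phi w v != 0) ->
  exists V : 'M[R]_n, \rank V = n.-1 /\ exists k : nat, forall w,
    (forall v, `|defect phi w v| <= `|v| / k.+1%:R) -> (w <= V)%MS.
Proof.
move=> [w0 [v0 d0]]; have [U UP] := additive_directions_mx.
have w0U : ~~ (w0 <= U)%MS by apply: contraNN d0 => /UP/(_ v0) ->.
have [V [rV UV]] := hyperplane_above w0U.
exists V; split=> //.
have w0N0 : w0 != 0 by apply: contraNneq w0U => ->; rewrite sub0mx.
have L0 := lip_cst_ge0 w0N0.
(* The unit sphere of a complement of [U]; membership in the complement is written as an equation so
   that it is visibly closed. *)
pose K := [set w : 'rV[R]_n | `|w| = 1] `&`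
          [set w : 'rV[R]_n | w *m cokermx (U^C)%MS = 0].
have Kcompact : compact K.
  apply: compact_closedI; first exact: unit_sphere_compact.
  rewrite (_ : [set w | _] = (fun w => w *m cokermx (U^C)%MS) @^-1` [set 0])//.
  apply: closed_comp => [w _|]; first exact: mulmxr_continuous.
  exact: (accessible_closed_set1 (hausdorff_accessible (@norm_hausdorff _ _))).

have /compact_near_coveringP Kcover := Kcompact.
pose P k w := exists v, `|v| / k.+1%:R < `|defect phi w v|.
have : \forall k \near \oo, K `<=` P k.
  apply: Kcover => w [/= w1 /eqP]; rewrite -submxE => wUC.
  have : ~ (w <= U)%MS.
    move=> wU; have : (w <= U :&: U^C)%MS by rewrite sub_capmx wU.
    rewrite capmx_compl submx0 => /eqP wE; move: w1; rewrite wE normr0.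
    by move=> /esym/eqP; rewrite oner_eq0.
  move=> /UP/existsNP[v /eqP dv].
  pose d := `|defect phi w v|; have d_gt0 : 0 < d by rewrite normr_gt0.
  near=> w' k; exists v.
  (* The defect at [w'] stays at least [3 * d / 4], above the bound [d / 4] of [h2]; dividing by
     [L + 1] also covers [L = 0]. *)
  have h1 : 2 * L * `|w - w'| <= d / 4.
    apply: (@le_trans _ _ (2 * L * (d / 8 / (L + 1)))).
      apply: ler_wpM2l; first by rewrite mulr_ge0.
      near: w'; apply: cvgr_dist_le; first exact: cvg_id.
      by rewrite !divr_gt0// ltr_wpDl.
    rewrite !mulrA ler_pdivrMr ?ltr_wpDl//; nra.
  have h2 : `|v| / k.+1%:R < d / 4.
    have v1 : 0 < `|v| + 1 by rewrite ltr_wpDl.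
    apply: (@lt_trans _ _ ((`|v| + 1) / k.+1%:R)).
      by rewrite ltr_pM2r ?invr_gt0// ltrDl.
    rewrite mulrC -ltr_pdivlMr//; near: k.
    have e0 : 0 < d / 4 / (`|v| + 1) by rewrite !divr_gt0.
    exact: (near_infty_natSinv_lt (PosNum e0)).
  have h3 := defect_lip w w' v.
  apply: (lt_trans h2).
  have := ler_distD (defect phi w' v) (defect phi w v) 0.
  rewrite !subr0 -/d; lra.
move=> /(@filter_ex _ _ _)[k Kk]; exists k => w hw.
apply: (submx_trans _ UV).
pose w1 := w *m proj_mx U (U^C)%MS; pose w2 := w *m proj_mx (U^C)%MS U.
have wE : w = w1 + w2.
  by rewrite add_proj_mx ?capmx_compl// submx_full// addsmx_compl_full.
have w1U : (w1 <= U)%MS by exact: proj_mx_sub.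
have w2U : (w2 <= U^C)%MS by exact: proj_mx_sub.
suff w20 : w2 = 0 by rewrite wE w20 addr0.
apply/eqP/negPn/negP => w2N0.
(* Removing the component [w1] in [U] leaves the defect unchanged, so [w2], rescaled to the sphere,
   inherits the bound [hw] and contradicts [Kk]. *)
have w2_gt0 : 0 < `|w2| by rewrite normr_gt0.
have dw2 v : defect phi w v = defect phi w2 v.
  have /UP h := w1U; move: (h w2) (h (w2 + v)).
  by rewrite wE /defect addrA => ? ?; lra.
have Kw2 : K (`|w2|^-1 *: w2).
  split => /=; first by rewrite normrZ normfV normr_id mulVf// gt_eqF.
  by apply/eqP; rewrite -submxE; exact: scalemx_sub.
have [v] := Kk _ Kw2.
rewrite -[X in defect _ _ X](scalerK (lt0r_neq0 w2_gt0)) defectZ ?invr_ge0//.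
rewrite -dw2 normrM normfV normr_id ltr_pdivlMl// => /lt_le_trans/(_ (hw _)).
by rewrite normrZ normr_id mulrA ltxx.
Unshelve. all: by end_near.
Qed.

End PositivelyHomogeneous.

(** * One-sided directional derivatives of a Lipschitz function *)

Lemma sup_lipschitz (R : realType) (n : nat) (f : 'rV[R]_n -> R) :
  lipschitz_fun f ->
  exists2 L : R, 0 <= L & forall x y, `|f x - f y| <= L * `|x - y|.
Proof.
move=> [L Lf]; exists (`|L| * n%:R) => [|x y]; first by rewrite mulr_ge0.
rewrite (le_trans (Lf x y))// -mulrA.
apply: (@le_trans _ _ (`|L| * enorm (x - y))).
  by rewrite ler_wpM2r ?ler_norm// sqrtr_ge0.
by rewrite ler_wpM2l// enorm_le.
Qed.

(** Allowing every vector [v], not only unit ones, and stating the limit with an error [e * l] keeps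
    quotients out of the later estimates. *)
Lemma dirderiv_exists (R : realType) (n : nat) (f : 'rV[R]_n -> R) :
  directionally_differentiable f ->
  exists g : 'rV[R]_n -> 'rV[R]_n -> R, forall x v e, 0 < e ->
    \forall l \near 0^'+, `|f (x + l *: v) - f x - l * g x v| <= e * l.
Proof.
move=> fdir.
have H (x v : 'rV[R]_n) : exists a, forall e, 0 < e ->
    \forall l \near 0^'+, `|f (x + l *: v) - f x - l * a| <= e * l.
  have [->|v0] := eqVneq v 0.
    exists 0 => e e0; near=> l.
    have l0 : 0 < l by near: l; exact: nbhs_right_gt.
    by rewrite scaler0 addr0 mulr0 !subrr normr0 mulr_ge0 ?ltW.
  have N0 : 0 < enorm v.
    by rewrite (lt_le_trans _ (mx_norm_le_enorm v))// normr_gt0.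
  have Nneq : enorm v != 0 by rewrite gt_eqF.
  have theta1 : enorm ((enorm v)^-1 *: v) = 1.
    have -> : enorm ((enorm v)^-1 *: v) = (enorm v)^-1 * enorm v.
      rewrite {1}/enorm; under eq_bigr do rewrite mxE exprMn.
      rewrite -mulr_sumr sqrtrM ?sqr_ge0// sqrtr_sqr ger0_norm//.
      by rewrite invr_ge0 ltW.
    by rewrite mulVf.
  have /cvg_ex[/= a /cvgrPdist_le fa] := fdir x _ theta1.
  (* A step [l] along [v] is a step [l * enorm v] along the unit vector in the direction of [v]. *)
  exists (enorm v * a) => e e0.
  have e'0 : 0 < e / enorm v by rewrite divr_gt0.
  have [d /= d0 fd] := fa _ e'0.
  near=> l; have l0 : 0 < l by near: l; exact: nbhs_right_gt.
  have ld : l < d / enorm v by near: l; apply: nbhs_right_lt; rewrite divr_gt0.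
  have lv0 : 0 < l * enorm v by rewrite mulr_gt0.
  have := fd (l * enorm v); rewrite /= sub0r normrN gtr0_norm// -ltr_pdivlMr//.
  move=> /(_ ld lv0); rewrite scalerA mulfK//.
  rewrite distrC -{1}[a](mulKf (lt0r_neq0 lv0)) [_^-1 * _]mulrC -mulrBl normrM.
  rewrite normfV (gtr0_norm lv0) ler_pdivrMr//.
  by rewrite !mulrA [_ * l * _]mulrAC divfK.
have [g gP] := choice (fun xv : 'rV[R]_n * 'rV[R]_n => H xv.1 xv.2).
by exists (fun x v => g (x, v)) => x v; exact: gP (x, v).
Unshelve. all: by end_near.
Qed.

Lemma differentiable_of_expansion (R : realType) (V W : normedModType R)
    (f : V -> W) (df : {linear V -> W}) (x : V) :
  continuous df ->
  (forall e, 0 < e ->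
    \forall v \near 0, `|f (x + v) - f x - df v| <= e * `|v|) ->
  differentiable f x.
Proof.
move=> df_cont fdf.
have fE : f \o shift x = cst (f x) + df +o_ 0 id.
  apply/eqaddoP => e e0; near=> v.
  have : `|f (x + v) - f x - df v| <= e * `|v| by near: v; exact: fdf.
  by rewrite -addrA -opprD addrC [x + v]addrC addrC.
by apply/diff_locallyP; rewrite (diff_unique df_cont fE).
Unshelve. all: by end_near.
Qed.

Section DirectionalDerivative.
Variables (R : realType) (n : nat) (f : 'rV[R]_n -> R) (L : R).
Variable g : 'rV[R]_n -> 'rV[R]_n -> R.
Hypothesis L_ge0 : 0 <= L.
Hypothesis f_lip : forall x y, `|f x - f y| <= L * `|x - y|.
Hypothesis g_deriv : forall x v e, 0 < e ->
  \forall l \near 0^'+, `|f (x + l *: v) - f x - l * g x v| <= e * l.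

Lemma dirderiv0 x : g x 0 = 0.
Proof.
apply/eqP; rewrite -normr_le0; apply/ler_addgt0Pr => e e0; rewrite add0r.
near (0 : R)^'+ => l.
have l0 : 0 < l by near: l; exact: nbhs_right_gt.
have : `|f (x + l *: 0) - f x - l * g x 0| <= e * l by near: l; exact: g_deriv.
rewrite scaler0 addr0 subrr sub0r normrN normrM gtr0_norm//.
by rewrite [leLHS]mulrC ler_pM2r.
Unshelve. all: by end_near.
Qed.

Lemma dirderivZ x t v : 0 <= t -> g x (t *: v) = t * g x v.
Proof.
rewrite le_eqVlt => /predU1P[<-|t0]; first by rewrite scale0r dirderiv0 mul0r.
apply/eqP; rewrite -subr_eq0 -normr_le0; apply/ler_addgt0Pr => e e0.
rewrite add0r.
have e2 : 0 < e / 2 by rewrite divr_gt0.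
have et2 : 0 < e / 2 / t by rewrite !divr_gt0.
have [d /= d0 gd] := g_deriv x v et2.
near (0 : R)^'+ => l.
have l0 : 0 < l by near: l; exact: nbhs_right_gt.
have ltd : l < d / t by near: l; apply: nbhs_right_lt; rewrite divr_gt0.
have : `|f (x + l *: (t *: v)) - f x - l * g x (t *: v)| <= e / 2 * l.
  by near: l; exact: g_deriv.
have lt0 : 0 < l * t by rewrite mulr_gt0.
have := gd (l * t); rewrite /= sub0r normrN gtr0_norm// -ltr_pdivlMr//.
move=> /(_ ltd lt0); rewrite scalerA.
have -> : e / 2 / t * (l * t) = e / 2 * l.
  by rewrite mulrCA -!mulrA mulVf ?gt_eqF// mulr1 mulrC -mulrA.
move=> h1 h2.
rewrite -(ler_pM2l l0) -[X in X * `|_| <= _](gtr0_norm l0) -normrM mulrBr.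
move: h1 h2; rewrite !ler_norml => /andP[? ?] /andP[? ?].
by apply/andP; split; lra.
Unshelve. all: by end_near.
Qed.

Lemma dirderiv_lip x v w : `|g x v - g x w| <= L * `|v - w|.
Proof.
apply/ler_addgt0Pr => e e0.
have e2 : 0 < e / 2 by rewrite divr_gt0.
near (0 : R)^'+ => l.
have l0 : 0 < l by near: l; exact: nbhs_right_gt.
have h1 : `|f (x + l *: v) - f x - l * g x v| <= e / 2 * l.
  by near: l; exact: g_deriv.
have h2 : `|f (x + l *: w) - f x - l * g x w| <= e / 2 * l.
  by near: l; exact: g_deriv.
have := f_lip (x + l *: v) (x + l *: w).
rewrite opprD addrACA subrr add0r -scalerBr normrZ gtr0_norm// => h3.
rewrite -(ler_pM2l l0) -[X in X * `|_| <= _](gtr0_norm l0) -normrM mulrBr.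
move: h1 h2 h3; rewrite !ler_norml => /andP[? ?] /andP[? ?] /andP[? ?].
by apply/andP; split; lra.
Unshelve. all: by end_near.
Qed.

(** Since [f] and [g x] are Lipschitz, the estimate in one direction persists in nearby directions.
    Compactness of the sphere makes the step size uniform, and homogeneity passes to all short
    [v]. *)
Lemma dirderiv_uniform x e : 0 < e -> exists2 d, 0 < d &
  forall v, `|v| < d -> `|f (x + v) - f x - g x v| <= e * `|v|.
Proof.
move=> e0.
have /compact_near_coveringP cover := @unit_sphere_compact R n.
pose P l w := `|f (x + l *: w) - f x - l * g x w| <= e * l.
have [d /= d0 dP] :
    \forall l \near 0^'+, [set w : 'rV[R]_n | `|w| = 1] `<=` P l.
  have e2 : 0 < e / 2 by rewrite divr_gt0.
  apply: cover => w /= _; near=> w' l.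
  have l0 : 0 < l by near: l; exact: nbhs_right_gt.
  have h1 : `|f (x + l *: w) - f x - l * g x w| <= e / 2 * l.
    by near: l; exact: g_deriv.
  (* Replacing [w] by [w'] costs one Lipschitz error for [f] and one for [g x], which explains the
     factor 2. *)
  have h2 : 2 * L * `|w - w'| <= e / 2.
    apply: (@le_trans _ _ (2 * L * (e / 4 / (L + 1)))).
      apply: ler_wpM2l; first by rewrite mulr_ge0.
      near: w'; apply: cvgr_dist_le; first exact: cvg_id.
      by rewrite !divr_gt0// ltr_wpDl.
    rewrite !mulrA ler_pdivrMr ?ltr_wpDl//; nra.
  have h3 : `|f (x + l *: w) - f (x + l *: w')| <= l * (L * `|w - w'|).
    have := f_lip (x + l *: w) (x + l *: w').
    rewrite opprD addrACA subrr add0r -scalerBr normrZ gtr0_norm//.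
    by rewrite mulrCA.
  have h4 : `|l * (g x w - g x w')| <= l * (L * `|w - w'|).
    by rewrite normrM gtr0_norm// ler_pM2l// dirderiv_lip.
  have h5 : l * (2 * L * `|w - w'|) <= l * (e / 2) by rewrite ler_pM2l.
  rewrite /P /=; move: h1 h3 h4; rewrite !ler_norml.
  by move=> /andP[? ?] /andP[? ?] /andP[? ?]; apply/andP; split; lra.
exists d => // v vd.
have [->|v0] := eqVneq v 0.
  by rewrite addr0 dirderiv0 !subrr !normr0 mulr0.
have v_gt0 : 0 < `|v| by rewrite normr_gt0.
have := dP `|v|; rewrite /= sub0r normrN normr_id.
move=> /(_ vd v_gt0 (`|v|^-1 *: v)).
rewrite /P/= scalerKV ?gt_eqF// dirderivZ ?invr_ge0// mulVKf ?gt_eqF//; apply.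
by rewrite normrZ normfV normr_id mulVf// gt_eqF.
Unshelve. all: by end_near.
Qed.

(** Additivity gives oddness, which extends positive homogeneity to linearity; the uniform expansion
    then makes [g x] the differential. *)
Lemma additive_differentiable x :
  (forall w v, defect (g x) w v = 0) -> differentiable f x.
Proof.
move=> gadd.
have gD w v : g x (w + v) = g x w + g x v.
  by have := gadd w v; rewrite /defect; lra.
have gN w : g x (- w) = - g x w.
  by have := gD w (- w); rewrite subrr dirderiv0; lra.
have glin : linear (g x : 'rV[R]_n -> R^o).
  move=> a u v; rewrite gD; congr (_ + _).
  have [a0|a0] := leP 0 a; first exact: dirderivZ.
  rewrite -[a]opprK scaleNr gN dirderivZ ?oppr_ge0 ?ltW//.
  by rewrite mulNr !opprK.
pose dg : {linear 'rV[R]_n -> R^o} :=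
  HB.pack (g x : 'rV[R]_n -> R^o) (GRing.isLinear.Build _ _ _ _ _ glin).
have dg_cont : continuous dg.
  apply: bounded_linear_continuous; apply/bounded_funP => r.
  exists (L * r) => y yr.
  have := dirderiv_lip x y 0; rewrite dirderiv0 !subr0 => /le_trans; apply.
  exact: ler_wpM2l.
apply: (@differentiable_of_expansion _ _ R^o f dg) => // e e0.
have [d d0 fd] := dirderiv_uniform x e0.
near=> v; have : `|v| < d by near: v; exact: cvgr0_norm_lt.
exact: fd.
Unshelve. all: by end_near.
Qed.

End DirectionalDerivative.

(** * A cone criterion for the slope, and finite nets *)

(** Reduces tangentiality to entering every cone around [V], measured in the sup norm. The strict
    inequality forces [oproj V (h i)] to be nonzero, which excludes the value [+oo]. *)
Lemma slope_ratio_cvg0 (R : realType) (n : nat) (V : 'M[R]_n)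
    (h : nat -> 'rV[R]_n) :
  (forall c, 0 < c -> \forall i \near \oo,
     `|oproj_perp V (h i)| < c * `|oproj V (h i)|) ->
  slope_ratio V (h i) @[i --> \oo] --> 0%E.
Proof.
move=> hc.
have proj_neq0 i c : `|oproj_perp V (h i)| < c * `|oproj V (h i)| ->
    oproj V (h i) != 0.
  move=> hi; apply: contraTneq hi => ->.
  by rewrite [ `|0| in X in _ < X]normr0 mulr0 -leNgt.
apply/fine_cvgP; split.
  near=> i; have /proj_neq0 : `|oproj_perp V (h i)| < 1 * `|oproj V (h i)|.
    by near: i; exact: hc.
  by rewrite /slope_ratio => /negbTE ->.
apply/cvgr0Pnorm_le => e e0.
(* The Euclidean norm in the numerator costs a factor [n]; adding 1 keeps the divisor positive. *)
have c0 : 0 < e / (n%:R + 1) by rewrite divr_gt0// ltr_wpDl.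
near=> i.
have hi : `|oproj_perp V (h i)| < e / (n%:R + 1) * `|oproj V (h i)|.
  by near: i; exact: hc.
rewrite /= /slope_ratio (negbTE (proj_neq0 _ _ hi))/=.
have p0 : 0 < `|oproj V (h i)| by rewrite normr_gt0 (proj_neq0 _ _ hi).
have ep0 : 0 < enorm (oproj V (h i)).
  by rewrite (lt_le_trans p0)// mx_norm_le_enorm.
rewrite ger0_norm ?divr_ge0 ?sqrtr_ge0// ler_pdivrMr//.
apply: (le_trans (enorm_le _)).
apply: (@le_trans _ _ (e * `|oproj V (h i)|)); last first.
  by rewrite ler_pM2l// mx_norm_le_enorm.
apply: (@le_trans _ _ ((n%:R + 1) * (e / (n%:R + 1) * `|oproj V (h i)|))).
  by rewrite ler_pM ?(ltW hi)// lerDl.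
by rewrite mulrA [_ * (e / _)]mulrCA mulfV ?mulr1// gt_eqF// ltr_wpDl.
Unshelve. all: by end_near.
Qed.

Lemma oproj_id (R : realType) (n : nat) (V : 'M[R]_n) (w : 'rV[R]_n) :
  (w <= V)%MS -> oproj V w = w.
Proof. by move=> wV; rewrite /oproj proj_mx_id// cap_orthocomp. Qed.

Lemma oproj_perp_eq0 (R : realType) (n : nat) (V : 'M[R]_n) (w : 'rV[R]_n) :
  (w <= V)%MS -> oproj_perp V w = 0.
Proof.
move=> wV; have [wE _ _] := oproj_decomp V w.
by apply/(addrI (oproj V w)); rewrite -wE addr0 oproj_id.
Qed.

Lemma finite_sphere_net (R : realType) (n : nat) (e : R) : 0 < e ->
  exists s : seq 'rV[R]_n, forall w : 'rV[R]_n, `|w| = 1 ->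
    exists2 q, q \in s & `|w - q| <= e.
Proof.
move=> e0; have := @unit_sphere_compact R n; rewrite compact_cover.
move=> /(_ _ setT (fun q => (ball q e)^°)) [q _||s _ sP].
- exact: open_interior.
- move=> w _; exists w => //; exact: nbhsx_ballx.
- exists (finmap.enum_fset s) => w /sP[q /= qs /interior_subset qw].
  exists q => //.
  by rewrite distrC ltW//; move: qw; rewrite -ball_normE.
Qed.

Lemma floor_eq_dist (R : realType) (a b : R) :
  Num.floor a = Num.floor b -> `|a - b| <= 1.
Proof.
move=> ab; have := floor_itv a; have := floor_itv b.
rewrite ab intrD => /andP[? ?] /andP[? ?].
by rewrite ler_norml; apply/andP; split; lra.
Qed.

(** * Tangentiality of a single piece *)

Section Tangential.
Variables (R : realType) (n : nat) (f : 'rV[R]_n -> R) (L : R).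
Variable g : 'rV[R]_n -> 'rV[R]_n -> R.
Hypothesis L_ge0 : 0 <= L.
Hypothesis f_lip : forall x y, `|f x - f y| <= L * `|x - y|.
Hypothesis g_deriv : forall x v e, 0 < e ->
  \forall l \near 0^'+, `|f (x + l *: v) - f x - l * g x v| <= e * l.

Variables (E : set 'rV[R]_n) (eta d : R).
Hypotheses (eta_gt0 : 0 < eta) (d_gt0 : 0 < d).
Hypothesis E_expansion : forall x v, E x -> `|v| < d ->
  `|f (x + v) - f x - g x v| <= eta / 4 * `|v|.
Hypothesis E_close : forall x y v, E x -> E y ->
  `|g x v - g y v| <= eta / 4 * `|v|.

(* If x and x + t w' both lie in E, with w' close to w, then expanding f at
   either point gives g_x (w + v) = g_x w + g_x v up to an error which, as
   t -> 0, is proportional to |v| alone. *)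
Lemma defect_isolated x w v : E x -> eta * `|v| < `|defect (g x) w v| ->
  \forall w' \near w & t \near 0^'+, ~ E (x + t *: w').
Proof.
move=> Ex; rewrite -subr_gt0; set r := _ - _ => r0.
have r8 : 0 < r / 8 by rewrite divr_gt0.
near=> w' t => /= Ey.
have t0 : 0 < t by near: t; exact: nbhs_right_gt.
have t0' : 0 <= t by exact: ltW.
have A : `|f (x + t *: (w + v)) - f x - t * g x (w + v)| <= r / 8 * t.
  by near: t; exact: g_deriv.
have B : `|f (x + t *: w) - f x - t * g x w| <= r / 8 * t.
  by near: t; exact: g_deriv.
have ww' : L * `|w - w'| <= r / 8.
  apply: (@le_trans _ _ (L * (r / 8 / (L + 1)))).
    apply: ler_wpM2l => //.
    near: w'; apply: cvgr_dist_le; first exact: cvg_id.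
    by rewrite !divr_gt0// ltr_wpDl.
  rewrite !mulrA ler_pdivrMr ?ltr_wpDl//; nra.
have lip u u' : u - u' = w - w' ->
    `|f (x + t *: u) - f (x + t *: u')| <= r / 8 * t.
  move=> uu'; apply: (le_trans (f_lip _ _)).
  rewrite opprD addrACA subrr add0r -scalerBr uu' normrZ gtr0_norm//.
  by rewrite mulrCA [leRHS]mulrC ler_pM2l.
have C := lip (w + v) (w' + v).
have D := lip w w' erefl.
have tv : `|t *: v| < d.
  rewrite normrZ gtr0_norm// (@le_lt_trans _ _ (t * (`|v| + 1)))//.
    by rewrite ler_pM2l// lerDl.
  rewrite -ltr_pdivlMr ?ltr_wpDl//; near: t; apply: nbhs_right_lt.
  by rewrite divr_gt0// ltr_wpDl.
(* Expansion at the second point [x + t *: w'] of the piece; [G] then replaces its derivative by the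
   one at [x]. *)
have F := E_expansion Ey tv.
rewrite (dirderivZ g_deriv)// normrZ (gtr0_norm t0) in F.
rewrite -[x + _ + _]addrA -scalerDr in F.
have G : `|t * (g x v - g (x + t *: w') v)| <= t * (eta / 4 * `|v|).
  by rewrite normrM (gtr0_norm t0) ler_pM2l// E_close.
have H : t * `|defect (g x) w v| = t * (eta * `|v| + r).
  by rewrite /r addrC subrK.
rewrite -{1}(gtr0_norm t0) -normrM in H.
have vpos : 0 <= t * (eta * `|v|) by rewrite !mulr_ge0// ltW.
have rpos : 0 < t * r by rewrite mulr_gt0.
have {}C := C _; rewrite opprD addrACA subrr addr0 in C; have {}C := C erefl.
(* The errors [A], [B], [C], [D] add up to [t * r / 2], and [F], [G] to half of [t * (eta * |v|)].
   The total is half of the value in [H], which is positive. *)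
suff : `|t * defect (g x) w v| <= t * (eta * `|v|) / 2 + t * r / 2 by lra.
rewrite /defect; move: A B C D F G; rewrite !ler_norml.
move=> /andP[? ?] /andP[? ?] /andP[? ?] /andP[? ?] /andP[? ?] /andP[? ?].
by apply/andP; split; lra.
Unshelve. all: by end_near.
Qed.

(** A direction off [V] has a large defect for some [v], so near it the piece has no points close to
    [x]. Compactness makes this uniform over all unit directions outside a cone around [V]. *)
Lemma tangential_of_gap :
  (forall x, E x -> exists V : 'M[R]_n, \rank V = n.-1 /\ forall w,
    (forall v, `|defect (g x) w v| <= eta * `|v|) -> (w <= V)%MS) ->
  tangential E.
Proof.
move=> gap x Ex; have [V [rV VP]] := gap x Ex.
exists V; split=> // h h0 Eh hcvg.
apply: slope_ratio_cvg0 => c c0.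
pose K := [set w : 'rV[R]_n | `|w| = 1] `&`
          [set w : 'rV[R]_n | 0 <= `|oproj_perp V w| - c * `|oproj V w| ].
have Kcompact : compact K.
  apply: compact_closedI; first exact: unit_sphere_compact.
  apply: (@closed_comp _ _ (fun w : 'rV[R]_n =>
      `|oproj_perp V w| - c * `|oproj V w|) [set r : R | 0 <= r]).
    have perp_c : continuous (fun w : 'rV[R]_n => `|oproj_perp V w|).
      exact: mulmxr_norm_continuous.
    have proj_c : continuous (fun w : 'rV[R]_n => `|oproj V w|).
      exact: mulmxr_norm_continuous.
    move=> w _.
    exact: (cvgB (perp_c w) (cvgM (cvg_cst c) (proj_c w))).
  exact: closed_ge.
have /compact_near_coveringP cover := Kcompact.
have [a /= a0 aP] : \forall t \near 0^'+, K `<=` (fun w => ~ E (x + t *: w)).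
  apply: cover => w [/= w1 wK].
  (* On a unit vector of [V] the cone condition would read [0 <= - c]. *)
  have : ~ (w <= V)%MS.
    move=> wV; move: wK; rewrite oproj_id// oproj_perp_eq0// w1 normr0.
    by rewrite mulr1 sub0r oppr_ge0 leNgt c0.
  move=> /(contra_not (VP w))/existsNP[v /negP]; rewrite -ltNge.
  exact: defect_isolated.
near=> i.
have hi0 : 0 < `|h i| by rewrite normr_gt0.
have hia : `|h i| < a by near: i; apply: cvgr0_norm_lt.
pose w := `|h i|^-1 *: h i.
have hE : h i = `|h i| *: w by rewrite scalerKV// gt_eqF.
have w1 : `|w| = 1 by rewrite normrZ normfV normr_id mulVf// gt_eqF.
(* Apply the uniform exclusion with step [|h i|] and the normalized direction [w]. *)
have := aP `|h i|; rewrite /= sub0r normrN normr_id => /(_ hia hi0 w).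
rewrite -hE => nK; rewrite ltNge; apply/negP => le_hi; apply: nK (Eh i).
split=> //=; rewrite /oproj /oproj_perp -!scalemxAl !normrZ normfV normr_id.
by rewrite mulrCA -mulrBr mulr_ge0 ?invr_ge0// subr_ge0.
Unshelve. all: by end_near.
Qed.

End Tangential.

(** * Countable coding of the directional derivatives *)

Section Signature.
Variables (R : realType) (n : nat) (f : 'rV[R]_n -> R) (L : R).
Variable g : 'rV[R]_n -> 'rV[R]_n -> R.
Hypothesis L_ge0 : 0 <= L.
Hypothesis f_lip : forall x y, `|f x - f y| <= L * `|x - y|.
Hypothesis g_deriv : forall x v e, 0 < e ->
  \forall l \near 0^'+, `|f (x + l *: v) - f x - l * g x v| <= e * l.

(** Equal floors make the derivatives differ by at most [r] on an [r]-net of the sphere. The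
    Lipschitz bound extends this to the sphere with error [2 * L * r + r], and [r] is chosen to make
    it [e]. Values in [seq int] leave only countably many classes. *)
Lemma dirderiv_signature (e : R) : 0 < e ->
  exists sig : 'rV[R]_n -> seq int, forall x y v, sig x = sig y ->
    `|g x v - g y v| <= e * `|v|.
Proof.
move=> e0; pose r := e / (2 * L + 1).
have r0 : 0 < r by rewrite divr_gt0// ltr_wpDl// mulr_ge0.
have [s sP] := @finite_sphere_net R n _ r0.
exists (fun x => [seq Num.floor (g x q / r) | q <- s]) => x y v /eq_in_map xy.
have sphere w : `|w| = 1 -> `|g x w - g y w| <= e.
  move=> /sP[q qs wq].
  have /floor_eq_dist := xy q qs.
  rewrite -mulrBl normrM [ `|r^-1|]gtr0_norm ?invr_gt0// ler_pdivrMr// mul1r.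
  have := dirderiv_lip f_lip g_deriv x w q.
  have := dirderiv_lip f_lip g_deriv y w q.
  have : L * `|w - q| <= L * r by rewrite ler_wpM2l.
  have -> : e = 2 * (L * r) + r.
    rewrite mulrA -{2}[r]mul1r -mulrDl mulrCA mulfV ?mulr1//.
    by rewrite gt_eqF// ltr_wpDl// mulr_ge0.
  move=> ?; rewrite !ler_norml => /andP[? ?] /andP[? ?] /andP[? ?].
  by apply/andP; split; lra.
have [->|v0] := eqVneq v 0.
  by rewrite !(dirderiv0 g_deriv) subrr !normr0 mulr0.
have v_gt0 : 0 < `|v| by rewrite normr_gt0.
have := sphere (`|v|^-1 *: v); rewrite !(dirderivZ g_deriv) ?invr_ge0//.
rewrite -mulrBr normrM normfV normr_id ler_pdivrMl// mulrC; apply.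
by rewrite normrZ normfV normr_id mulVf// gt_eqF.
Qed.

End Signature.

(** * Assembly of the countable cover *)

Theorem theorem1p1 (R : realType) (n : nat) (hn : (0 < n)%N)
    (f : 'rV[R]_n -> R)
    (f_lip : lipschitz_fun f)
    (f_dir : directionally_differentiable f) :
  exists E : nat -> set 'rV[R]_n,
    (forall i, tangential (E i)) /\
    [set x : 'rV[R]_n | ~ differentiable f x] `<=` \bigcup_i E i.
Proof.
have [L L0 fL] := sup_lipschitz f_lip.
have [g gP] := dirderiv_exists f_dir.
(* The same sequence supplies the gaps, indexed by [k], and the radii of expansion, indexed by
   [m]. *)
pose eta (k : nat) : R := k.+1%:R^-1.
have eta4 k : 0 < eta k / 4 by rewrite divr_gt0// invr_gt0.
have [sig sigP] := choice (fun k => dirderiv_signature L0 fL gP (eta4 k)).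
pose gap k x := exists V : 'M[R]_n, \rank V = n.-1 /\ forall w,
  (forall v, `|defect (g x) w v| <= eta k * `|v|) -> (w <= V)%MS.
pose piece (i : nat * nat * seq int) : set 'rV[R]_n :=
  let: (k, m, s) := i in
  [set x | [/\ gap k x, sig k x = s & forall v, `|v| < eta m ->
    `|f (x + v) - f x - g x v| <= eta k / 4 * `|v| ] ].
(* The index type is countable, so [unpickle] enumerates the pieces; numbers coding no index give
   [set0], which is vacuously tangential. *)
exists (fun i => if unpickle i is Some j then piece j else set0); split.
  move=> i; case: unpickle => [[[k m] s]|]; last by [].
  apply: (@tangential_of_gap _ _ f L g L0 fL gP (piece (k, m, s))
    (eta k) (eta m)).
  - by rewrite invr_gt0.
  - by rewrite invr_gt0.
  - by move=> x v [_ _]; exact.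
  - by move=> x y v [_ sx _] [_ sy _]; apply: sigP; rewrite sx sy.
  - by move=> x [].
move=> x /= ndf.
have ndefect : exists w v, defect (g x) w v != 0.
  apply: contrapT => nd; apply: ndf; apply: (additive_differentiable L0 fL gP).
  move=> w v; apply/eqP/negPn/negP => dwv; apply: nd; by exists w, v.
have [V [rV [k VP]]] := additivity_gap (@dirderivZ _ _ _ _ gP x)
  (dirderiv_lip fL gP x) ndefect.
have [d d0 dP] := dirderiv_uniform L0 fL gP x (eta4 k).
near \oo => m.
exists (pickle (k, m, sig k x)) => //; rewrite pickleK; split=> //.
  exists V; split=> // w wP; apply: VP => v.
  by rewrite [leRHS]mulrC; exact: wP.
move=> v vm; apply: dP; apply: (lt_trans vm); near: m.
exact: (near_infty_natSinv_lt (PosNum d0)).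
Unshelve. all: by end_near.
Qed.
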